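(* Let $F$ be a field of arbitrary characteristic and $n\ge 1$. Let $A_n=F[x_1,\dots,x_n;y_1,\dots,y_n]$ be the polynomial algebra, and in the $\Gamma$-algebra $\Gamma(A_n)$ let $v_i=(x_i,y_i)$ $(1\le i\le n)$, $V=\sum_{i=1}^nFv_i$, $\alpha_{ij}=v_iv_j=x_iy_j-x_jy_i$, and $S_n=F[\alpha_{ij}\mid 1\le i<j\le n]\subset A_n$. Then the space $S_n+S_nV$ is a subalgebra of the algebra $\Gamma(A_n)$ which is isomorphic to the free $\Gamma$-algebra $\Gamma[\emptyset;V]$ on the space $V$ of odd generators. It has a base $B_n\cup\left(\bigcup_{j=1}^nB_{n,j}v_j\right)$ over $F$.
   Context: Algebras are not assumed associative; $[a,b]=ab-ba$, $(a,b,c)=(ab)c-a(bc)$, and $Z(\cdot)$ denotes the center. A $\Gamma$-algebra is a $\mathbb Z_2$-graded $F$-algebra $\Gamma=\Gamma_0\oplus\Gamma_1$ such that: (i) $\Gamma_0$ is a unital associative algebra (whose identity is the identity of $\Gamma$), $[\Gamma_0,\Gamma_1]=0$ and $(\Gamma_0,\Gamma,\Gamma)=0$ (associators whose first entry is in $\Gamma_0$ vanish); (ii) $\Gamma_1^2\subseteq Z(\Gamma_0)$; (iii) $xy+yx=0$ for $x,y\in\Gamma_1$; (iv) $(xy)z+(yz)x+(zx)y=0$ for $x,y,z\in\Gamma_1$. The free $\Gamma$-algebra $\Gamma[\emptyset;V]$ on a space $V$ of odd generators is the $\Gamma$-algebra with a linear map from $V$ to its odd part such that every linear map $V\to\Gamma_1$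 into the odd part of a $\Gamma$-algebra $\Gamma$ extends uniquely to a unital grading-preserving homomorphism to $\Gamma$. For a unital commutative associative algebra $A$, $\Gamma(A)=A\oplus A^2$ is the $\Gamma$-algebra with even part $A$, odd part $A^2$ and multiplication extending that of $A$ by $a\cdot(b,c)=(b,c)\cdot a=(ab,ac)$, $(a,b)\cdot(c,d)=ad-bc$. $B_n=\{\alpha_{i_1j_1}\alpha_{i_2j_2}\cdots\alpha_{i_rj_r}\mid r\ge0,\ i_1\le i_2\le\cdots\le i_r,\ j_1\le j_2\le\cdots\le j_r,\ i_s<j_s\}$ (including the empty product $1$), and for $1\le m\le n$, $B_{n,m}=\{\alpha_{i_1j_1}\cdots\alpha_{i_rj_r}\in B_n\mid j_1\ge m\}$ (including $1$).
   Formalization: In characteristic 2, axiom (iii) of a Γ-algebra is strengthened to include xx=0 for odd x; with only xy+yx=0 the theorem fails there (e.g. Γ=⟨1,t⟩⊕⟨x⟩, xx=t, tt=tx=xt=0). In other characteristics nothing changes. *)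

(* Defs.v *)
From HB Require Import structures.
From mathcomp Require Import all_boot all_algebra.
From mathcomp Require Import boolp mpoly.
From mathcomp Require Import ring.

Set Implicit Arguments.
Unset Strict Implicit.
Unset Printing Implicit Defensive.

Import GRing.Theory.
Local Open Scope ring_scope.

Reserved Notation "x *g y" (at level 40, left associativity).

(* A not necessarily associative algebra, graded by Z_2 = (bool, addb):
   [gpart false] is the even part and [gpart true] the odd part. [gone] is the
   candidate unit; that it is one is part of [gamma_algebra]. *)
Record gradedAlgebra (F : fieldType) := GradedAlgebra {
  gcarrier :> lmodType F;
  gmul : gcarrier -> gcarrier -> gcarrier;
  gone : gcarrier;
  gpart : bool -> {pred gcarrier};
  gmul_linearl : forall y, linear (fun x => gmul x y);
  gmul_linearr : forall x, linear (gmul x);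
  gpart_submod : forall e, GRing.submod_closed (gpart e);
  gpart_sum : forall x, exists x0 x1,
    [/\ x0 \in gpart false, x1 \in gpart true & x = x0 + x1];
  gpart_cap : forall x, x \in gpart false -> x \in gpart true -> x = 0;
  gpart_mul : forall d e x y,
    x \in gpart d -> y \in gpart e -> gmul x y \in gpart (d (+) e)
}.

Notation "x *g y" := (gmul x y) : ring_scope.
Notation geven G := (@gpart _ G false).
Notation godd G := (@gpart _ G true).

Section GammaAlgebras.
Variable F : fieldType.
Implicit Types G H : gradedAlgebra F.

Definition gcomm G (a b : G) : G := a *g b - b *g a.
Definition gassoc G (a b c : G) : G := (a *g b) *g c - a *g (b *g c).

Definition gcenter G (S : {pred G}) (z : G) : Prop :=
  [/\ z \in S,
      forall a, a \in S -> gcomm z a = 0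
    & forall a b, a \in S -> b \in S ->
        [/\ gassoc z a b = 0, gassoc a z b = 0 & gassoc a b z = 0]].

(* In characteristic 2 the anticommutativity of the odd part has to be read as
   the alternating law x x = 0: [gamma_alternating] follows from
   [gamma_anticomm] in every other characteristic, but not in this one. *)
Record gamma_algebra G : Prop := GammaAlgebra {
  gamma_one_even : gone G \in geven G;
  gamma_mul1x : forall x : G, gone G *g x = x;
  gamma_mulx1 : forall x : G, x *g gone G = x;
  gamma_even_assoc : forall a b c : G,
    a \in geven G -> b \in geven G -> c \in geven G -> gassoc a b c = 0;
  gamma_comm : forall a x : G,
    a \in geven G -> x \in godd G -> gcomm a x = 0;
  gamma_assoc : forall a b c : G, a \in geven G -> gassoc a b c = 0;
  gamma_odd_sqr : forall x y : G,
    x \in godd G -> y \in godd G -> gcenter (geven G) (x *g y);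
  gamma_anticomm : forall x y : G,
    x \in godd G -> y \in godd G -> x *g y + y *g x = 0;
  gamma_alternating : 2%N \in [pchar F] -> forall x : G,
    x \in godd G -> x *g x = 0;
  gamma_cyclic : forall x y z : G,
    x \in godd G -> y \in godd G -> z \in godd G ->
    (x *g y) *g z + (y *g z) *g x + (z *g x) *g y = 0
}.

Record graded_hom G H (f : G -> H) : Prop := GradedHom {
  ghom_linear : linear f;
  ghom_mul : forall x y, f (x *g y) = f x *g f y;
  ghom_one : f (gone G) = gone H;
  ghom_part : forall e x, x \in @gpart _ G e -> f x \in @gpart _ H e
}.

Definition free_gamma (V : lmodType F) G (iota : {linear V -> G}) : Prop :=
  [/\ gamma_algebra G,
      forall v, iota v \in godd G
    & forall H (f : {linear V -> H}),
        gamma_algebra H -> (forall v, f v \in godd H) ->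
        exists phi : G -> H,
          [/\ graded_hom phi,
              forall v, phi (iota v) = f v
            & forall psi : G -> H, graded_hom psi ->
                (forall v, psi (iota v) = f v) -> psi =1 phi]].

Definition subalgebra G (S : {pred G}) : Prop :=
  GRing.submod_closed S /\ {in S &, forall x y, x *g y \in S}.

Definition sumspace (L : lmodType F) (P Q : {pred L}) : {pred L} :=
  fun u => `[< exists p q, [/\ p \in P, q \in Q & u = p + q] >].

(* Meant for a [P] that is closed under scalars, so that the sums of products
   already form a subspace. *)
Definition mulspace G (P Q : {pred G}) : {pred G} :=
  fun u => `[< exists s : seq (G * G),
    all (fun p => (p.1 \in P) && (p.2 \in Q)) s
    /\ u = \sum_(p <- s) p.1 *g p.2 >].

Definition base_of (L : lmodType F) (X W : {pred L}) : Prop :=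
  [/\ {subset X <= W},
      forall u, u \in W -> exists (s : seq L) (c : L -> F),
        {subset s <= X} /\ u = \sum_(x <- s) c x *: x
    & forall (s : seq L) (c : L -> F), uniq s -> {subset s <= X} ->
        \sum_(x <- s) c x *: x = 0 -> forall x, x \in s -> c x = 0].

Definition generated_subalg (A : comAlgType F) (X : {pred A}) : {pred A} :=
  fun a => `[< forall S : {pred A},
    GRing.subalg_closed S -> {subset X <= S} -> a \in S >].

End GammaAlgebras.

Section SpanSpace.
Variables (F : fieldType) (L : lmodType F) (n : nat) (v : 'I_n -> L).

Definition span_pred : {pred L} :=
  fun u => `[< exists c : 'I_n -> F, u = \sum_(i < n) c i *: v i >].

Lemma span_pred_submod : GRing.submod_closed span_pred.
Proof.
split.
  apply/asboolP; exists (fun=> 0).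
  by rewrite big1 // => i _; rewrite scale0r.
move=> a x y /asboolP[c ->] /asboolP[d ->]; apply/asboolP.
exists (fun i => a * c i + d i).
rewrite scaler_sumr -big_split; apply: eq_bigr => i _ /=.
by rewrite scalerDl scalerA.
Qed.

HB.instance Definition _ :=
  GRing.isSubmodClosed.Build F L span_pred span_pred_submod.

Record span_space : Type := SpanSpace {
  span_val :> L;
  span_valP : span_val \in span_pred
}.

HB.instance Definition _ := [isSub for span_val].
HB.instance Definition _ := [Choice of span_space by <:].
HB.instance Definition _ := [SubChoice_isSubLmodule of span_space by <:].

End SpanSpace.

Section GammaOf.
Variables (F : fieldType) (A : comAlgType F).

Local Notation L := (A * (A * A))%type.

Definition gammaOf_mul (u w : L) : L :=
  (u.1 * w.1 + (u.2.1 * w.2.2 - u.2.2 * w.2.1),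
   (u.1 * w.2.1 + w.1 * u.2.1, u.1 * w.2.2 + w.1 * u.2.2)).

Definition gammaOf_part (e : bool) : {pred L} :=
  if e then (fun u => u.1 == 0) else (fun u => u.2 == 0).

Let eq_triple (u w : L) :
  u.1 = w.1 -> u.2.1 = w.2.1 -> u.2.2 = w.2.2 -> u = w.
Proof. by case: u w => a [b c] [a' [b' c']] /= -> -> ->. Qed.

Fact gammaOf_linearl (y : L) : linear (fun x => gammaOf_mul x y).
Proof.
move=> k [a [b c]] [a' [b' c']]; case: y => d [e f].
apply: eq_triple => /=;
  rewrite !(mulrDl, mulrDr) -!(scalerAl, scalerAr) !(scalerDr, scalerN); ring.
Qed.

Fact gammaOf_linearr (x : L) : linear (gammaOf_mul x).
Proof.
move=> k [a [b c]] [a' [b' c']]; case: x => d [e f].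
apply: eq_triple => /=;
  rewrite !(mulrDl, mulrDr) -!(scalerAl, scalerAr) !(scalerDr, scalerN); ring.
Qed.

Fact gammaOf_submod e : GRing.submod_closed (gammaOf_part e).
Proof.
case: e; split; rewrite ?unfold_in //= => k x y; rewrite !unfold_in /=;
  by move=> /eqP-> /eqP->; rewrite scaler0 addr0.
Qed.

Fact gammaOf_sum (x : L) : exists x0 x1,
  [/\ x0 \in gammaOf_part false, x1 \in gammaOf_part true & x = x0 + x1].
Proof.
exists (x.1, 0), (0, x.2); split; rewrite ?unfold_in //=.
by case: x => a [b c]; congr (_, (_, _)); rewrite /= ?addr0 ?add0r.
Qed.

Fact gammaOf_cap (x : L) :
  x \in gammaOf_part false -> x \in gammaOf_part true -> x = 0.
Proof. by case: x => a b; rewrite !unfold_in /= => /eqP-> /eqP->. Qed.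

Let evenE (x : L) : x \in gammaOf_part false -> x = (x.1, (0, 0)).
Proof. by case: x => a b; rewrite unfold_in => /eqP /= ->. Qed.

Let oddE (x : L) : x \in gammaOf_part true -> x = (0, (x.2.1, x.2.2)).
Proof. by case: x => a [b c]; rewrite unfold_in => /eqP /= ->. Qed.

Fact gammaOf_part_mul d e (x y : L) :
  x \in gammaOf_part d -> y \in gammaOf_part e ->
  gammaOf_mul x y \in gammaOf_part (d (+) e).
Proof.
by case: d => [/oddE|/evenE] ->; case: e => [/oddE|/evenE] ->;
  rewrite unfold_in /gammaOf_mul /= ?(mulr0, mul0r, addr0, subr0).
Qed.

Definition gammaOf : gradedAlgebra F :=
  @GradedAlgebra F L gammaOf_mul (1, 0) gammaOf_part gammaOf_linearl
    gammaOf_linearr gammaOf_submod gammaOf_sum gammaOf_cap gammaOf_part_mul.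

Lemma gammaOf_gamma : gamma_algebra gammaOf.
Proof.
split.
- by rewrite unfold_in.
- by move=> x; apply: eq_triple => /=; ring.
- by move=> x; apply: eq_triple => /=; ring.
- move=> a b c /evenE-> /evenE-> /evenE->.
  by apply: eq_triple => /=; ring.
- by move=> a x /evenE-> /oddE->; apply: eq_triple => /=; ring.
- by move=> a b c /evenE->; apply: eq_triple => /=; ring.
- move=> x y ox oy; split.
  + exact: (@gammaOf_part_mul true true).
  + by move=> a /evenE->; rewrite (oddE ox) (oddE oy);
      apply: eq_triple => /=; ring.
  + by move=> a b /evenE-> /evenE->; rewrite (oddE ox) (oddE oy);
      split; apply: eq_triple => /=; ring.
- by move=> x y /oddE-> /oddE->; apply: eq_triple => /=; ring.
- by move=> _ x /oddE->; apply: eq_triple => /=; ring.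
- by move=> x y z /oddE-> /oddE-> /oddE->; apply: eq_triple => /=; ring.
Qed.

End GammaOf.

Section Tableaux.
Variables (F : fieldType) (n : nat).

Definition polyA : comAlgType F := {mpoly F[n + n]}.
Definition GammaA : gradedAlgebra F := gammaOf polyA.

Definition xvar (i : 'I_n) : polyA := 'X_(lshift n i).
Definition yvar (i : 'I_n) : polyA := 'X_(rshift n i).

Definition vgen (i : 'I_n) : GammaA := (0, (xvar i, yvar i)).
Definition alpha (i j : 'I_n) : polyA := xvar i * yvar j - xvar j * yvar i.

(* The space V as a vector space in its own right. *)
Definition Vspace : lmodType F := span_space vgen.

Definition evenA (a : polyA) : GammaA := (a, 0).

Lemma vgen_mul (i j : 'I_n) : vgen i *g vgen j = evenA (alpha i j).
Proof.
by congr (_, (_, _)); rewrite /= ?(mul0r, addr0, add0r, mulr0) // /alpha;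
  congr (_ - _); rewrite mulrC.
Qed.

Definition Salg : {pred polyA} :=
  generated_subalg
    (fun a => `[< exists i j : 'I_n, (i < j)%N /\ a = alpha i j >]).

Definition SalgG : {pred GammaA} :=
  fun u => `[< exists2 a, a \in Salg & u = evenA a >].

Definition SplusSV : {pred GammaA} :=
  sumspace SalgG (mulspace SalgG (span_pred vgen)).

(* The word alpha_{i_1 j_1} ... alpha_{i_r j_r} is encoded by the sequence
   [:: (i_1, j_1); ...; (i_r, j_r)]; indices start at 0. *)
Definition standard_word (w : seq ('I_n * 'I_n)) : bool :=
  [&& sorted (fun p q : 'I_n * 'I_n => p.1 <= q.1)%N w,
      sorted (fun p q : 'I_n * 'I_n => p.2 <= q.2)%N w
    & all (fun p : 'I_n * 'I_n => p.1 < p.2)%N w].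

Definition starts_from (m : 'I_n) (w : seq ('I_n * 'I_n)) : bool :=
  if w is p :: _ then (m <= p.2)%N else true.

Definition alpha_word (w : seq ('I_n * 'I_n)) : polyA :=
  \prod_(p <- w) alpha p.1 p.2.

Definition Bstd : {pred polyA} :=
  fun a => `[< exists2 w, standard_word w & a = alpha_word w >].

Definition Bstd_from (m : 'I_n) : {pred polyA} :=
  fun a => `[< exists w,
    [/\ standard_word w, starts_from m w & a = alpha_word w] >].

Definition Gbase : {pred GammaA} :=
  fun u => `[< (exists2 a, a \in Bstd & u = evenA a) \/
    (exists (j : 'I_n) (a : polyA), a \in Bstd_from j /\ u = evenA a *g vgen j) >].

End Tableaux.

Arguments Salg F n _ : clear implicits.
Arguments SalgG F n _ : clear implicits.
Arguments SplusSV F n _ : clear implicits.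
Arguments Bstd F n _ : clear implicits.
Arguments Gbase F n _ : clear implicits.

(* Main.v *)
Require Import Defs.
From HB Require Import structures.
From mathcomp Require Import all_boot all_algebra order.
From mathcomp Require Import boolp mpoly.
From mathcomp Require Import zify.

(** Why the theorem holds.

    Fix odd elements h_1, ..., h_n of any Gamma-algebra H and put
    [ij] = h_i h_j. A tailed word is a product of brackets [ij] with i < j,
    possibly followed by one letter h_m; it is standard when it is one of the
    monomials of the asserted base, with h_i in the place of v_i.

    Straightening. The axioms of a Gamma-algebra give two exchange rules. The
    cyclic identity reads [ij] h_m = [im] h_j - [jm] h_i, and multiplying it on
    the right by a fourth odd element gives the three-term Pluecker relation
    [ij][kl] = [kj][il] - [ik][lj]. Since brackets are central in the even part
    and associators that start with a bracket vanish, the order of the brackets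
    in a word is irrelevant, so a word without tail is standard, up to order,
    unless it contains brackets with i < k < l < j; the Pluecker relation
    removes such a nesting and decreases the sum of the squares (j - i)^2. A
    tail h_m that lies above a whole bracket [ij] is exchanged for the smaller
    tails h_i and h_j. Hence the standard tailed words span a subalgebra of H,
    whatever H is ([standard_span_mul]).

    Independence. In Gamma(A_n) the linear map (a, (b, c)) |-> a + c sends a
    standard tailed word to a product of polynomials alpha_ij and possibly one
    y_m. Order the monomials by degree and then lexicographically with
    x_1 > ... > x_n > y_1 > ... > y_n; then the leading monomial of
    alpha_ij (i < j) is x_i y_j, so the leading monomial of the image records
    the multiset of the first indices and that of the second indices, tail
    included. In a standard tailed word both are listed in increasing order, so
    the leading monomial determines the word, and a tail shows up as one
    surplus y ([word_mon_inj], [word_val_free]). Together with straightening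
    this identifies S_n + S_n V with the span of the standard tailed words in
    the v_i and gives the base.

    Freeness. Let f be a linear map from V to the odd part of a Gamma-algebra
    H. In the product Gamma-algebra Gamma(A_n) x H consider the span D of the
    standard tailed words in the odd elements (v_i, f v_i). By straightening it
    is a subalgebra; it projects onto S_n + S_n V, and injectively so because
    the first components of the standard tailed words are independent. Hence D
    is the graph of a map S_n + S_n V -> H, which is the homomorphism that
    extends f ([free_extension]). *)

Set Implicit Arguments.
Unset Strict Implicit.
Unset Printing Implicit Defensive.

Import Order.TTheory GRing.Theory.
Local Open Scope ring_scope.

Local Notation word n := (seq ('I_n * 'I_n)).
Local Notation tailed_word n := (seq ('I_n * 'I_n) * option 'I_n)%type.

(** * Spans of families of vectors *)

Section SpanBy.
Variables (F : fieldType) (L : lmodType F) (I : eqType) (P : pred I) (e : I -> L).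

(** The indices of a combination are required to be distinct, so that the
    linear independence of the family applies to it directly. *)
Definition span_by : {pred L} :=
  fun u => `[< exists (s : seq I) (c : I -> F),
    [/\ uniq s, all P s & u = \sum_(i <- s) c i *: e i] >].

Lemma span_by_extend (s r : seq I) (c : I -> F) :
  uniq s -> uniq r -> {subset s <= r} ->
  \sum_(i <- s) c i *: e i =
  \sum_(i <- r) (if i \in s then c i else 0) *: e i.
Proof.
move=> us ur sr.
transitivity (\sum_(i <- r | i \in s) c i *: e i); last first.
  rewrite big_mkcond; apply: eq_bigr => i _.
  by case: ifP => //; rewrite scale0r.
rewrite -[RHS]big_filter; apply: perm_big; apply: uniq_perm => //.
  exact: filter_uniq.
by move=> i; rewrite mem_filter; case: (boolP (i \in s)) => // /sr->.
Qed.

Lemma span_by_submod : GRing.submod_closed span_by.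
Proof.
split; first by apply/asboolP; exists [::], (fun=> 0); rewrite big_nil.
move=> a x y /asboolP[s [c [us Ps ->]]] /asboolP[t [d [ut Pt ->]]].
pose r := undup (s ++ t).
apply/asboolP; exists r, (fun i => a * (if i \in s then c i else 0)
  + (if i \in t then d i else 0)); split; first exact: undup_uniq.
  apply/allP=> i; rewrite mem_undup mem_cat.
  by case/orP=> [/(allP Ps)|/(allP Pt)].
have sr : {subset s <= r} by move=> i; rewrite mem_undup mem_cat => ->.
have tr : {subset t <= r} by move=> i; rewrite mem_undup mem_cat orbC => ->.
rewrite (span_by_extend c us _ sr) ?undup_uniq //.
rewrite (span_by_extend d ut _ tr) ?undup_uniq //.
rewrite scaler_sumr -big_split; apply: eq_bigr => i _.
by rewrite scalerDl scalerA.
Qed.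

HB.instance Definition _ :=
  GRing.isSubmodClosed.Build F L span_by span_by_submod.

Lemma mem_span_by i : P i -> e i \in span_by.
Proof.
move=> Pi; apply/asboolP; exists [:: i], (fun=> 1).
by rewrite big_seq1 scale1r /= Pi.
Qed.

Lemma span_by_ind (Q : L -> Prop) :
  Q 0 -> (forall a x y, Q x -> Q y -> Q (a *: x + y)) ->
  (forall i, P i -> Q (e i)) -> forall u, u \in span_by -> Q u.
Proof.
move=> Q0 Qlin Qe u /asboolP[s [c [_ Ps ->]]].
elim: s Ps => [|i s IHs] /=; first by rewrite big_nil.
by case/andP=> Pi Ps; rewrite big_cons; apply: Qlin; [apply: Qe | apply: IHs].
Qed.

End SpanBy.

(** * Computing in a Gamma-algebra *)

Section GradedAlgebraTheory.
Variables (F : fieldType) (G : gradedAlgebra F).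
Implicit Types x y z : G.

HB.instance Definition _ x :=
  GRing.isLinear.Build F G G *:%R (gmul x) (gmul_linearr x).

Definition gmulr y x : G := x *g y.

HB.instance Definition _ y :=
  GRing.isLinear.Build F G G *:%R (gmulr y) (gmul_linearl y).

HB.instance Definition _ e :=
  GRing.isSubmodClosed.Build F G (@gpart _ G e) (gpart_submod G e).

Lemma gmulDl x y z : (x + y) *g z = x *g z + y *g z.
Proof. exact: (linearD (gmulr z)). Qed.

Lemma gmulNl x y : (- x) *g y = - (x *g y).
Proof. exact: (linearN (gmulr y)). Qed.

Lemma gmulZl a x y : (a *: x) *g y = a *: (x *g y).
Proof. exact: (linearZ_LR (gmulr y)). Qed.

Lemma gmul0l y : 0 *g y = 0.
Proof. exact: (linear0 (gmulr y)). Qed.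

Hypothesis gG : gamma_algebra G.

Lemma even_mulA a y z : a \in geven G -> (a *g y) *g z = a *g (y *g z).
Proof. by move=> ea; apply/subr0_eq/(gamma_assoc gG). Qed.

Lemma even_odd_mulC a x : a \in geven G -> x \in godd G -> a *g x = x *g a.
Proof. by move=> ea ox; apply/subr0_eq/(gamma_comm gG). Qed.

Lemma odd_mul_even x y : x \in godd G -> y \in godd G -> x *g y \in geven G.
Proof. exact: gpart_mul. Qed.

Lemma odd_mul_central x y a : x \in godd G -> y \in godd G -> a \in geven G ->
  (x *g y) *g a = a *g (x *g y).
Proof.
move=> ox oy ea; have [_ + _] := gamma_odd_sqr gG ox oy.
by move=> /(_ a ea) /subr0_eq.
Qed.

Lemma odd_mulNC x y : x \in godd G -> y \in godd G -> x *g y = - (y *g x).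
Proof. by move=> ox oy; apply/eqP; rewrite -addr_eq0 (gamma_anticomm gG). Qed.

(** Anticommutativity only gives 2 x x = 0, whence the two cases. *)
Lemma odd_mulxx x : x \in godd G -> x *g x = 0.
Proof.
move=> ox; have [char2|char2] := boolP (2%N \in [pchar F]).
  exact: gamma_alternating gG char2 _ ox.
have := gamma_anticomm gG ox ox.
rewrite -mulr2n -scaler_nat => /eqP; rewrite scaler_eq0 => /orP[two0|/eqP//].
by rewrite inE /= two0 in char2.
Qed.

(** On an even z this is commutation of odd with even elements. On an odd z it
    is anticommutation, used twice, so that the signs cancel. *)
Lemma odd_mulCA x a z : x \in godd G -> a \in geven G ->
  x *g (a *g z) = a *g (x *g z).
Proof.
move=> ox ea; have [z0 [z1 [ez0 oz1 ->]]] := gpart_sum z.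
rewrite !linearD /=; congr (_ + _).
  rewrite -even_odd_mulC ?(gpart_mul ea ez0) // even_mulA //.
  by rewrite (even_odd_mulC ez0 ox).
rewrite odd_mulNC ?(gpart_mul ea oz1) // even_mulA //.
by rewrite (odd_mulNC oz1 ox) linearN opprK.
Qed.

Lemma odd_cyclic x y z : x \in godd G -> y \in godd G -> z \in godd G ->
  (x *g y) *g z = (z *g y) *g x + (x *g z) *g y.
Proof.
move=> ox oy oz; have /eqP := gamma_cyclic gG ox oy oz.
rewrite -addrA addr_eq0 opprD => /eqP->.
by rewrite (odd_mulNC oy oz) (odd_mulNC oz ox) !gmulNl !opprK.
Qed.

(** The Pluecker relation, as an identity between operators acting on u: the
    cyclic identity for x, y, z times t. *)
Lemma plucker x y z t u :
  x \in godd G -> y \in godd G -> z \in godd G -> t \in godd G ->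
  (x *g y) *g ((z *g t) *g u) =
  (z *g y) *g ((x *g t) *g u) - (x *g z) *g ((t *g y) *g u).
Proof.
move=> ox oy oz ot.
have eE w v : w \in godd G -> v \in godd G -> w *g v \in geven G.
  exact: odd_mul_even.
have E : (x *g y) *g (z *g t) =
    (z *g y) *g (x *g t) - (x *g z) *g (t *g y).
  rewrite -even_mulA ?eE // (odd_cyclic ox oy oz) gmulDl.
  rewrite (even_mulA x t (eE _ _ oz oy)) (even_mulA y t (eE _ _ ox oz)).
  by rewrite (odd_mulNC oy ot) linearN.
rewrite -(even_mulA _ u (eE _ _ ox oy)) E gmulDl gmulNl.
by rewrite !(even_mulA _ u (eE _ _ _ _)).
Qed.

End GradedAlgebraTheory.

(** * Standard words and straightening *)

Section Words.
Variable n : nat.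

Definition increasing : pred (word n) := all (fun p : 'I_n * 'I_n => p.1 < p.2)%N.

Definition standard : pred (tailed_word n) := fun k =>
  standard_word k.1 && (if k.2 is Some j then starts_from j k.1 else true).

Definition nested (p q : 'I_n * 'I_n) : bool :=
  (p.1 < q.1)%N && (q.2 < p.2)%N.

(** Squares, because a sum of lengths need not decrease in an exchange: for
    i < k < l < j one of the two resulting words has j - k and l - i in the
    place of the lengths j - i and l - k, which is the same sum, but more evenly
    divided. *)
Definition spread (w : word n) : nat := \sum_(p <- w) (p.2 - p.1) ^ 2.

Lemma standard_increasing (w : word n) : standard_word w -> increasing w.
Proof. by case/and3P. Qed.

(** When the pairs are sorted lexicographically, a descent in the second indices
    would be a nesting. *)
Lemma unnested_standard (w : word n) : increasing w ->
  (forall p q, p \in w -> q \in w -> ~~ nested p q) ->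
  exists2 w', perm_eq w w' & standard_word w'.
Proof.
move=> incw unw.
pose le (p q : 'I_n * 'I_n) :=
  (p.1 < q.1)%N || ((p.1 == q.1) && (p.2 <= q.2)%N).
have le_total : total le.
  by move=> p q; rewrite /le -!(inj_eq val_inj) /=; lia.
exists (sort le w); first by rewrite perm_sym perm_sort.
have sle := sort_sorted le_total w.
apply/and3P; split.
- apply: sub_sorted sle => p q.
  by rewrite /le -(inj_eq val_inj) /=; lia.
- have : all (mem w) (sort le w) by apply/allP=> p; rewrite mem_sort.
  move: sle => /[swap]; apply: sub_in_sorted => p q pw qw.
  have := unw _ _ pw qw.
  by rewrite /nested /le -(inj_eq val_inj) /=; lia.
- by rewrite all_sort.
Qed.

End Words.

Section Straightening.
Variables (F : fieldType) (n : nat) (H : gradedAlgebra F).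
Implicit Types (h : 'I_n -> H) (w : word n) (p q : 'I_n * 'I_n) (u : H).

Definition bracket h p : H := h p.1 *g h p.2.

(** H is not associative, so a product of brackets depends on the order of
    evaluation. Letting every bracket act by left multiplication turns the
    factors into commuting operators, and the tail is what they act on. *)
Definition word_act h w u : H := foldr (fun p t => bracket h p *g t) u w.

Definition tail_val h (o : option 'I_n) : H :=
  if o is Some j then h j else gone H.

Definition word_val h (k : tailed_word n) : H := word_act h k.1 (tail_val h k.2).

Definition standard_span h : {pred H} := span_by (@standard n) (word_val h).

Lemma word_act_cons h p w u :
  word_act h (p :: w) u = bracket h p *g word_act h w u.
Proof. by []. Qed.

Lemma word_act_cat h w1 w2 u :
  word_act h (w1 ++ w2) u = word_act h w1 (word_act h w2 u).
Proof. exact: foldr_cat. Qed.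

Lemma word_act_linear h w : linear (word_act h w).
Proof.
move=> a u v; elim: w => //= p w ->.
by rewrite linearP.
Qed.

HB.instance Definition _ h w :=
  GRing.isLinear.Build F H H *:%R (word_act h w) (word_act_linear h w).

Hypothesis gH : gamma_algebra H.
Variable h : 'I_n -> H.
Hypothesis hodd : forall i, h i \in godd H.

Lemma bracket_even p : bracket h p \in geven H.
Proof. exact: odd_mul_even. Qed.

Lemma bracketC p q u :
  bracket h p *g (bracket h q *g u) = bracket h q *g (bracket h p *g u).
Proof.
have ep := bracket_even p; have eq := bracket_even q.
rewrite -(even_mulA gH _ u ep) -(even_mulA gH _ u eq); congr (_ *g u).
exact: odd_mul_central.
Qed.

Lemma word_act_bracket w p u :
  word_act h w (bracket h p *g u) = bracket h p *g word_act h w u.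
Proof. by elim: w => //= q w ->; rewrite bracketC. Qed.

Lemma perm_word_act w1 w2 u : perm_eq w1 w2 -> word_act h w1 u = word_act h w2 u.
Proof.
elim: w1 w2 => [|p w1 IHw] w2 /=; first by rewrite perm_sym => /perm_nilP->.
move=> pw; have pw2 : p \in w2 by rewrite -(perm_mem pw) mem_head.
case/splitPr: pw2 pw => w3 w4 pw; rewrite word_act_cat /= word_act_bracket.
rewrite -word_act_cat -IHw // -(perm_cons p) (permPl pw).
exact: (permEl (perm_catCA w3 [:: p] w4)).
Qed.

Lemma word_act_even w u : u \in geven H -> word_act h w u \in geven H.
Proof.
by move=> eu; elim: w => //= p w; apply: gpart_mul (bracket_even p).
Qed.

Lemma word_act_odd w u : u \in godd H -> word_act h w u \in godd H.
Proof.
by move=> eu; elim: w => //= p w; apply: gpart_mul (bracket_even p).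
Qed.

Lemma word_act_mul w u v : word_act h w u *g v = word_act h w (u *g v).
Proof.
by elim: w => //= p w <-; rewrite even_mulA ?bracket_even.
Qed.

Lemma odd_mul_word x w u :
  x \in godd H -> x *g word_act h w u = word_act h w (x *g u).
Proof.
by move=> ox; elim: w => //= p w <-; rewrite odd_mulCA ?bracket_even.
Qed.

(** Straightening of the brackets alone; the vector u they act on is arbitrary,
    so the same lemma serves words with and without tail. *)
Lemma word_act_straighten w u : increasing w ->
  word_act h w u \in span_by (@standard_word n) (fun w' => word_act h w' u).
Proof.
have [m] := ubnP (spread w); elim: m w => // m IHm w sw incw.
have [/hasP[[i j] pw /hasP[[k l] qw nst]]|/hasPn unst] :=
    boolP (has (fun p => has (nested p) w) w); last first.
  have [|w' pww' stw'] := unnested_standard incw.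
    by move=> p q pw qw; have /hasPn/(_ q qw) := unst p pw.
  by rewrite (perm_word_act _ pww'); apply: mem_span_by.
(* A nested pair of letters is brought to the front. *)
have [w' pww'] : exists w', perm_eq w [:: (i, j), (k, l) & w'].
  exists (rem (k, l) (rem (i, j) w)).
  rewrite (perm_trans (perm_to_rem pw)) // perm_cons perm_to_rem //.
  move: qw; rewrite (perm_mem (perm_to_rem pw)) inE => /orP[/eqP[ki lj]|//].
  by move: nst; rewrite /nested /= ki lj; lia.
move: incw sw nst; rewrite /increasing (perm_all _ pww') /spread /nested.
rewrite (perm_big _ pww') !big_cons /= => /and3P[ij kl incw'] sw /andP[ik lj].
rewrite (perm_word_act _ pww') /= /bracket plucker //.
apply: rpredB.
- apply: (IHm [:: (k, j), (i, l) & w']); last by rewrite /increasing /= incw'; lia.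
  move: sw; rewrite /spread !big_cons /=; nia.
- apply: (IHm [:: (i, k), (l, j) & w']); last by rewrite /increasing /= incw'; lia.
  move: sw; rewrite /spread !big_cons /=; nia.
Qed.

(** The induction is on the tail m. If, after straightening, the first bracket
    [ij] has j < m, the cyclic identity replaces the tail by i or j. The
    brackets [im] and [jm] that appear may destroy standardness, which the
    induction hypothesis does not ask for. *)
Lemma odd_word_standard w m : increasing w ->
  word_act h w (h m) \in standard_span h.
Proof.
have [N] := ubnP (val m); elim: N m w => // N IHN m w mN incw.
elim/span_by_ind: (word_act_straighten (h m) incw) => [|a x y|w' stw'].
- exact: rpred0.
- by move=> xS yS; rewrite rpredD ?rpredZ.
have [fromm|] := boolP (starts_from m w').
  by apply: (@mem_span_by _ _ _ _ (word_val h) (w', Some m)); apply/andP.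
case: w' stw' => [//|[i j] w'] stw' /=; rewrite -ltnNge => jm.
have /andP[/= ij incw'] := standard_increasing stw'.
rewrite -word_act_bracket /bracket /= odd_cyclic // (odd_mulNC gH (hodd m)) //.
rewrite gmulNl addrC linearB /=.
rewrite -/(bracket h (i, m)) -/(bracket h (j, m)) !word_act_bracket.
apply: rpredB.
- apply: (IHN j ((i, m) :: w')); first exact: leq_trans jm _.
  by apply/andP; split=> //=; lia.
- apply: (IHN i ((j, m) :: w')); first by move: mN => /=; lia.
  by apply/andP; split=> //=; lia.
Qed.

Lemma tailed_word_standard w o : increasing w ->
  word_act h w (tail_val h o) \in standard_span h.
Proof.
case: o => [m|] incw; first exact: odd_word_standard.
elim/span_by_ind: (word_act_straighten (gone H) incw) => [|a x y|w' stw'].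
- exact: rpred0.
- by move=> xS yS; rewrite rpredD ?rpredZ.
by apply: (@mem_span_by _ _ _ _ (word_val h) (w', None)); apply/andP.
Qed.

Lemma standard_span_one : gone H \in standard_span h.
Proof. exact: (@tailed_word_standard [::] None). Qed.

Lemma standard_span_gen i : h i \in standard_span h.
Proof. exact: (@tailed_word_standard [::] (Some i)). Qed.

Lemma odd_pair_standard w i j : increasing w ->
  word_act h w (h i *g h j) \in standard_span h.
Proof.
move=> incw; have inc1 (k l : 'I_n) : (k < l)%N ->
    word_act h w (h k *g h l) \in standard_span h.
  move=> kl; have -> : h k *g h l = bracket h (k, l) *g gone H.
    by rewrite gamma_mulx1.
  rewrite word_act_bracket.
  by apply: (@tailed_word_standard ((k, l) :: w) None); apply/andP.
case: (ltngtP i j) => [/inc1 //|ji|/val_inj->].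
  by rewrite odd_mulNC // linearN rpredN inc1.
by rewrite odd_mulxx // linear0 rpred0.
Qed.

(** Brackets can be pulled out of a product of two words, also past an odd tail
    of the first one, and two tails merge into one more bracket. *)
Lemma standard_span_mul : {in standard_span h &, forall x y,
  x *g y \in standard_span h}.
Proof.
move=> x y + yS; elim/span_by_ind => [|a x1 x2 x1S x2S|[w o] /andP[/= stw _]].
- by rewrite gmul0l rpred0.
- by rewrite gmulDl gmulZl rpredD ?rpredZ.
elim/span_by_ind: yS => [|a y1 y2 y1S y2S|[w' o'] /andP[/= stw' _]].
- by rewrite linear0 rpred0.
- by rewrite linearP /= rpredD ?rpredZ.
have incww : increasing (w ++ w').
  by rewrite /increasing all_cat; apply/andP; split; apply: standard_increasing.
rewrite /word_val word_act_mul; case: o => [j|] /=.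
  rewrite odd_mul_word // -word_act_cat; case: o' => [k|] /=.
    exact: odd_pair_standard.
  by rewrite gamma_mulx1 //; apply: (tailed_word_standard (Some j)).
by rewrite gamma_mul1x // -word_act_cat; apply: tailed_word_standard.
Qed.

Lemma standard_span_homogeneous x : x \in standard_span h ->
  exists x0 x1, [/\ x0 \in standard_span h, x0 \in geven H,
    x1 \in standard_span h, x1 \in godd H & x = x0 + x1].
Proof.
elim/span_by_ind => [|a y z|[w o] stw].
- by exists 0, 0; rewrite !rpred0 addr0.
- move=> [y0 [y1 [? ? ? ? ->]]] [z0 [z1 [? ? ? ? ->]]].
  exists (a *: y0 + z0), (a *: y1 + z1).
  by rewrite scalerDr addrACA; split=> //; rewrite rpredD ?rpredZ.
have valS := mem_span_by (word_val h) stw.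
case: o stw valS => [j|] stw valS.
  exists 0, (word_val h (w, Some j)); rewrite !rpred0 add0r; split=> //.
  exact: (word_act_odd w (hodd j)).
exists (word_val h (w, None)), 0; rewrite !rpred0 addr0; split=> //.
exact: (word_act_even w (gamma_one_even gH)).
Qed.

End Straightening.

(** * Graded homomorphisms *)

Section GradedHoms.
Variables (F : fieldType) (G H : gradedAlgebra F) (f : G -> H).
Hypothesis homf : graded_hom f.

Lemma ghom_word_val n (h : 'I_n -> G) k :
  f (word_val h k) = word_val (f \o h) k.
Proof.
case: k => w o; rewrite /word_val /=; elim: w => /= [|p w <-].
  by case: o => //=; apply: ghom_one.
by rewrite /bracket !(ghom_mul homf).
Qed.

Let fL := GRing.isLinear.Build F G H *:%R f (ghom_linear homf).
HB.instance Definition _ := fL.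

Lemma ghom0 : f 0 = 0. Proof. exact: linear0. Qed.
Lemma ghomP a x y : f (a *: x + y) = a *: f x + f y.
Proof. exact: linearP. Qed.
Lemma ghomD x y : f (x + y) = f x + f y. Proof. exact: linearD. Qed.

End GradedHoms.

Lemma ghom_eq_span (F : fieldType) (G H : gradedAlgebra F) (f g : G -> H) n
    (h : 'I_n -> G) :
  graded_hom f -> graded_hom g -> (forall i, f (h i) = g (h i)) ->
  {in standard_span h, f =1 g}.
Proof.
move=> homf homg fg x; elim/span_by_ind => [|a y z yfg zfg|k _].
- by rewrite !ghom0.
- by rewrite !ghomP // yfg zfg.
by rewrite !ghom_word_val //; congr word_val; apply: funext.
Qed.

(** * Leading monomials and linear independence *)

Section LeadIndependence.
Variables (F : fieldType) (m : nat).

Lemma mlead_max (J : eqType) (s : seq J) (p : J -> {mpoly F[m]}) :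
  s != [::] -> exists2 j, j \in s &
    {in s, forall i, (mlead (p i) <= mlead (p j))%O}.
Proof.
elim: s => // i s IHs _; have [->|/IHs[j js jmax]] := eqVneq s [::].
  by exists i; rewrite ?mem_head // => k; rewrite inE => /eqP->.
have [le_ij|lt_ji] := leP (mlead (p i)) (mlead (p j)).
  exists j => [|k]; rewrite inE ?js ?orbT // => /orP[/eqP->//|]; exact: jmax.
exists i => [|k]; rewrite inE ?eqxx // => /orP[/eqP->//|/jmax le_kj].
exact: le_trans le_kj (ltW lt_ji).
Qed.

(** In a relation, look at the coefficient of the largest leading monomial among
    the terms with a nonzero coefficient: no other term contributes to it. *)
Lemma mlead_free (J : eqType) (s : seq J) (c : J -> F) (p : J -> {mpoly F[m]}) :
  uniq s -> {in s, forall i, p i != 0} -> {in s &, injective (fun i => mlead (p i))} ->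
  \sum_(i <- s) c i *: p i = 0 -> {in s, forall i, c i = 0}.
Proof.
move=> us nz inj sum0 i is_; apply/eqP/negPn/negP=> ci.
pose t := [seq k <- s | c k != 0].
have [|j] := mlead_max (s := t) p.
  by apply/eqP=> t0; have : i \in t by [rewrite mem_filter ci]; rewrite t0.
rewrite mem_filter => /andP[cj js] jmax.
suff /eqP : (\sum_(k <- s) c k *: p k)@_(mlead (p j)) = c j * mleadc (p j).
  by rewrite sum0 mcoeff0 eq_sym mulf_eq0 (negPf cj) mleadc_eq0 (negPf (nz _ js)).
rewrite (raddf_sum (mcoeff (mlead (p j)))) (bigD1_seq j) //= mcoeffZ.
rewrite big_seq_cond big1 ?addr0 // => k /andP[ks kj].
rewrite mcoeffZ; have [->|ck] := eqVneq (c k) 0; first by rewrite mul0r.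
rewrite mcoeff_gt_mlead ?mulr0 // lt_neqAle jmax ?mem_filter ?ck // andbT.
by apply: contraNneq kj => /inj->.
Qed.

End LeadIndependence.

Section StandardMonomials.
Variable n : nat.
Implicit Types (w : word n) (k : tailed_word n).

Definition pair_mon (p : 'I_n * 'I_n) : 'X_{1..n + n} :=
  (U_(lshift n p.1) + U_(rshift n p.2))%MM.

Definition word_mon k : 'X_{1..n + n} :=
  (\sum_(p <- k.1) pair_mon p
   + (if k.2 is Some j then U_(rshift n j) else 0))%MM.

Definition firsts k : seq 'I_n := [seq p.1 | p <- k.1].
Definition seconds k : seq 'I_n :=
  (if k.2 is Some j then cons j else id) [seq p.2 | p <- k.1].

Lemma word_mon_first k i : word_mon k (lshift n i) = count_mem i (firsts k).
Proof.
case: k => w o; rewrite /word_mon /firsts mnmDE /= mnm_sumE.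
have -> : (if o is Some j then U_(rshift n j) else 0)%MM (lshift n i) = 0%N.
  by case: o => [j|]; rewrite ?mnm0E // mnm1E eq_rlshift.
rewrite addn0 count_map -sum1_count [RHS]big_mkcond /=; apply: eq_bigr => p _.
by rewrite mnmDE !mnm1E eq_rlshift addn0 eq_lshift; case: eqP.
Qed.

Lemma word_mon_second k j : word_mon k (rshift n j) = count_mem j (seconds k).
Proof.
case: k => w o; rewrite /word_mon /seconds mnmDE /= mnm_sumE.
have -> : (\sum_(p <- w) pair_mon p (rshift n j))%N =
    count_mem j [seq p.2 | p <- w].
  rewrite count_map -sum1_count [RHS]big_mkcond /=; apply: eq_bigr => p _.
  by rewrite mnmDE !mnm1E eq_lrshift eq_rshift; case: eqP.
by case: o => [l|]; rewrite ?mnm0E ?addn0 // mnm1E eq_rshift addnC.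
Qed.

Lemma standard_sorted k : standard k ->
  sorted leq (map val (firsts k)) /\ sorted leq (map val (seconds k)).
Proof.
case: k => w o; rewrite /standard /firsts /seconds /=.
case/andP=> /and3P[s1 s2 _] fromo; rewrite -map_comp sorted_map; split=> //.
case: o fromo => [j|] /=; last by rewrite -map_comp sorted_map.
by case: w s2 {s1} => //= p w; rewrite !path_map => -> ->.
Qed.

(** The exponents of the x_i and y_j count the first and second indices, and
    standardness says that these are listed in increasing order. The
    presence of a tail is read off from the two lengths. *)
Lemma word_mon_inj : {in @standard n &, injective word_mon}.
Proof.
move=> k l stk stl kl.
have [[k1 k2] [l1 l2]] := (standard_sorted stk, standard_sorted stl).
have eq_ord (s t : seq 'I_n) : sorted leq (map val s) -> sorted leq (map val t) ->
    (forall i, count_mem i s = count_mem i t) -> s = t.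
  move=> ss st st_count; apply: (inj_map val_inj).
  apply: (sorted_eq leq_trans anti_leq ss st); apply: perm_map.
  by apply/allP=> i _; rewrite /= st_count.
have e1 : firsts k = firsts l.
  by apply: eq_ord => // i; rewrite -!word_mon_first kl.
have e2 : seconds k = seconds l.
  by apply: eq_ord => // i; rewrite -!word_mon_second kl.
case: k l e1 e2 {stk stl kl k1 k2 l1 l2} => [w o] [w' o'].
rewrite /firsts /seconds /= => e1 e2.
have sz : size w = size w' by rewrite -(size_map fst) e1 size_map.
have eqw : map snd w = map snd w' -> w = w'.
  by move=> e; rewrite -(zip_unzip w) -(zip_unzip w') /unzip1 /unzip2 e1 e.
case: o o' e2 => [j|] [j'|] /= e2.
- by case: e2 => -> /eqw->.
- by have /= := congr1 size e2; rewrite !size_map sz; lia.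
- by have /= := congr1 size e2; rewrite !size_map sz; lia.
- by rewrite (eqw e2).
Qed.

End StandardMonomials.

Section StandardLead.
Variables (F : fieldType) (n : nat).
Implicit Types (w : word n) (k : tailed_word n).

(** Monomials of the same degree are compared lexicographically, with the x_i
    before the y_j, so that x_i y_j beats x_j y_i. *)
Lemma mlead_alpha (p : 'I_n * 'I_n) : (p.1 < p.2)%N ->
  mlead (alpha F p.1 p.2 : {mpoly F[n + n]}) = pair_mon p.
Proof.
case: p => i j /= ij.
have -> : (alpha F i j : {mpoly F[n + n]}) =
    'X_[pair_mon (i, j)] - 'X_[pair_mon (j, i)] by rewrite !mpolyXD.
rewrite mleadDl ?mleadN ?mleadXm //.
apply/ltmcP; first by rewrite !mdegD !mdeg1.
have in_ := ltn_ord i.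
exists (lshift n i) => [l /= li|]; rewrite /pair_mon /= !mnmDE !mnm1E -!val_eqE /=.
  by rewrite !gtn_eqF; lia.
by rewrite eqxx !gtn_eqF; lia.
Qed.

(** One coordinate of the odd part suffices, and it can be added to the even part
    without confusion: even words become polynomials of even degree and words
    with a tail polynomials of odd degree. *)
Definition lead_part (u : GammaA F n) : {mpoly F[n + n]} := u.1 + u.2.2.

Lemma lead_part_linear : linear lead_part.
Proof. by move=> a u v; rewrite /lead_part /= scalerDr addrACA. Qed.

HB.instance Definition _ :=
  GRing.isLinear.Build F (GammaA F n) {mpoly F[n + n]} *:%R lead_part
    lead_part_linear.

Lemma evenA_mul (a : polyA F n) (u : GammaA F n) :
  evenA a *g u = (a * u.1, (a * u.2.1, a * u.2.2)).
Proof.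
by congr (_, (_, _)); rewrite /= ?mulr0 ?mul0r ?subr0 ?addr0.
Qed.

Lemma word_act_vgen w (u : GammaA F n) :
  word_act (@vgen F n) w u = evenA (alpha_word F w) *g u.
Proof.
rewrite evenA_mul /alpha_word; elim: w => [|p w IHw].
  by case: u => u0 [u1 u2]; rewrite big_nil !mul1r.
by rewrite word_act_cons IHw /bracket vgen_mul evenA_mul big_cons /= !mulrA.
Qed.

Lemma lead_part_word_val k : lead_part (word_val (@vgen F n) k) =
  alpha_word F k.1 * (if k.2 is Some j then yvar F j else 1).
Proof.
case: k => w o; rewrite /word_val word_act_vgen evenA_mul /lead_part /=.
by case: o => [j|] /=; rewrite mulr0 ?addr0 ?add0r.
Qed.

Lemma mlead_word_val k : standard k ->
  lead_part (word_val (@vgen F n) k) != 0 /\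
  mlead (lead_part (word_val (@vgen F n) k)) = word_mon k.
Proof.
case: k => w o /andP[/standard_increasing/= incw _]; rewrite lead_part_word_val /=.
have alpha_neq0 p : p \in w -> (alpha F p.1 p.2 : {mpoly F[n + n]}) != 0.
  move/(allP incw)/mlead_alpha => lead_p; apply/eqP=> alpha0.
  move: lead_p; rewrite alpha0 mlead0 => /(congr1 (@mdeg _)).
  by rewrite mdeg0 mdegD !mdeg1.
set a := alpha_word F w.
have {a} -> : a = \prod_(p <- w) (alpha F p.1 p.2 : {mpoly F[n + n]}) by [].
have word_neq0 : \prod_(p <- w) (alpha F p.1 p.2 : {mpoly F[n + n]}) != 0.
  by rewrite prodf_seq_neq0; apply/allP => p /alpha_neq0.
have tail_neq0 : ((if o is Some j then yvar F j else 1) : {mpoly F[n + n]}) != 0.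
  case: o => [j|]; last exact: oner_neq0.
  by rewrite /yvar -mleadc_eq0 mleadXm mcoeffX eqxx oner_neq0.
split; first exact: mulf_neq0.
rewrite mleadM // mlead_prod => [|p pw _]; last exact: alpha_neq0.
congr (_ + _)%MM.
  by apply: eq_big_seq => p pw; rewrite mlead_alpha ?(allP incw).
by case: o {tail_neq0} => [j|]; rewrite ?mleadXm ?mlead1.
Qed.

(** The words are indexed through an injective [key], so that this applies both
    to families of words and to families of vectors that are values of words. *)
Lemma word_val_free (J : eqType) (s : seq J) (c : J -> F) key :
  uniq s -> {in s, forall i, standard (key i)} -> {in s &, injective key} ->
  \sum_(i <- s) c i *: word_val (@vgen F n) (key i) = 0 ->
  {in s, forall i, c i = 0}.
Proof.
move=> us stkey injkey sum0.
pose p i := lead_part (word_val (@vgen F n) (key i)).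
apply: (@mlead_free _ _ _ s c p us) => [i is_|i j is_ js|].
- by have [] := mlead_word_val (stkey i is_).
- rewrite /p; have [_ ->] := mlead_word_val (stkey i is_).
  have [_ ->] := mlead_word_val (stkey j js).
  by move/word_mon_inj => /(_ (stkey i is_) (stkey j js)) /injkey; apply.
- rewrite -[RHS](linear0 lead_part) -sum0 linear_sum /=.
  by apply: eq_bigr => i _; rewrite linearZ.
Qed.

End StandardLead.

(** * Products and subalgebras of Gamma-algebras *)

Section JointlyInjective.
Variables (F : fieldType) (G : gradedAlgebra F).
Variables (I : Type) (H : I -> gradedAlgebra F) (f : forall i, G -> H i).
Hypothesis gammaH : forall i, gamma_algebra (H i).
Hypothesis homf : forall i, graded_hom (@f i).
Hypothesis jinj : forall x, (forall i, f i x = 0) -> x = 0.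

Let fB i x y : f i (x - y) = f i x - f i y.
Proof. by rewrite addrC -scaleN1r (ghomP (homf i)) scaleN1r addrC. Qed.

Let feq x y : (forall i, f i x = f i y) -> x = y.
Proof.
by move=> fxy; apply/subr0_eq/jinj => i; rewrite fB fxy subrr.
Qed.

Let fassoc i x y z : f i (gassoc x y z) = gassoc (f i x) (f i y) (f i z).
Proof. by rewrite /gassoc fB !(ghom_mul (homf i)). Qed.

Let fcomm i x y : f i (gcomm x y) = gcomm (f i x) (f i y).
Proof. by rewrite /gcomm fB !(ghom_mul (homf i)). Qed.

(** The identities can be checked after applying the homomorphisms. Only the
    evenness of the unit is not an identity: its odd component is mapped into
    the even part by every homomorphism, hence to zero. The lemma serves products,
    through the two projections, and subalgebras, through the inclusion. *)
Lemma gamma_algebra_of_homs : gamma_algebra G.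
Proof.
have fpart i e x : x \in @gpart _ G e -> f i x \in @gpart _ (H i) e.
  exact: ghom_part.
split.
- have [x0 [x1 [ex0 ox1 def1]]] := gpart_sum (gone G).
  suff x1_0 : x1 = 0 by rewrite def1 x1_0 addr0.
  apply: jinj => i; apply: gpart_cap (fpart i _ _ ox1).
  rewrite -[x1](addKr x0) -def1 addrC fB (ghom_one (homf i)).
  by rewrite rpredB ?gamma_one_even ?fpart.
- move=> x; apply: feq => i.
  by rewrite (ghom_mul (homf i)) (ghom_one (homf i)) gamma_mul1x.
- move=> x; apply: feq => i.
  by rewrite (ghom_mul (homf i)) (ghom_one (homf i)) gamma_mulx1.
- move=> a b c ea eb ec; apply: jinj => i.
  by rewrite fassoc gamma_even_assoc ?fpart.
- by move=> a x ea ox; apply: jinj => i; rewrite fcomm gamma_comm ?fpart.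
- by move=> a b c ea; apply: jinj => i; rewrite fassoc gamma_assoc ?fpart.
- move=> x y ox oy; have central i := gamma_odd_sqr (gammaH i)
    (fpart i _ _ ox) (fpart i _ _ oy).
  split; first exact: gpart_mul ox oy.
    move=> a ea; apply: jinj => i; rewrite fcomm (ghom_mul (homf i)).
    by have [_ -> //] := central i; apply: fpart.
  move=> a b ea eb; split; apply: jinj => i; rewrite fassoc (ghom_mul (homf i));
    have [_ _ /(_ _ _ (fpart i _ _ ea) (fpart i _ _ eb)) []] := central i;
    by move=> ? ? ?.
- move=> x y ox oy; apply: jinj => i.
  by rewrite (ghomD (homf i)) !(ghom_mul (homf i)) gamma_anticomm ?fpart.
- move=> char2 x ox; apply: jinj => i.
  by rewrite (ghom_mul (homf i)) gamma_alternating ?fpart.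
- move=> x y z ox oy oz; apply: jinj => i.
  by rewrite !(ghomD (homf i)) !(ghom_mul (homf i)) gamma_cyclic ?fpart.
Qed.

End JointlyInjective.

Section ProductAlgebra.
Variables (F : fieldType) (G H : gradedAlgebra F).

Local Notation L := (G * H)%type.

Definition gprod_mul (u v : L) : L := (u.1 *g v.1, u.2 *g v.2).

Definition gprod_part e : {pred L} :=
  fun u => (u.1 \in @gpart _ G e) && (u.2 \in @gpart _ H e).

Fact gprod_linearl (y : L) : linear (fun x => gprod_mul x y).
Proof.
by move=> a u v; congr (_, _); rewrite /= gmulDl gmulZl.
Qed.

Fact gprod_linearr (x : L) : linear (gprod_mul x).
Proof. by move=> a u v; congr (_, _); rewrite /= linearP. Qed.

Fact gprod_submod e : GRing.submod_closed (gprod_part e).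
Proof.
split=> [|a u v /andP[? ?] /andP[? ?]]; apply/andP; first by rewrite !rpred0.
by rewrite /= !rpredD ?rpredZ.
Qed.

Fact gprod_sum (u : L) : exists u0 u1,
  [/\ u0 \in gprod_part false, u1 \in gprod_part true & u = u0 + u1].
Proof.
case: u => x y; have [x0 [x1 [? ? ->]]] := gpart_sum x.
have [y0 [y1 [? ? ->]]] := gpart_sum y.
by exists (x0, y0), (x1, y1); split=> //; apply/andP.
Qed.

Fact gprod_cap (u : L) :
  u \in gprod_part false -> u \in gprod_part true -> u = 0.
Proof.
case: u => x y /andP[/= ? ?] /andP[/= ? ?].
by congr (_, _); apply: gpart_cap.
Qed.

Fact gprod_part_mul d e (u v : L) :
  u \in gprod_part d -> v \in gprod_part e -> gprod_mul u v \in gprod_part (d (+) e).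
Proof.
by move=> /andP[? ?] /andP[? ?]; apply/andP; split; apply: gpart_mul.
Qed.

Definition gprod : gradedAlgebra F :=
  @GradedAlgebra F L gprod_mul (gone G, gone H) gprod_part gprod_linearl
    gprod_linearr gprod_submod gprod_sum gprod_cap gprod_part_mul.

Lemma gprod_fst_hom : graded_hom (fst : gprod -> G).
Proof. by split=> // e u /andP[]. Qed.

Lemma gprod_snd_hom : graded_hom (snd : gprod -> H).
Proof. by split=> // e u /andP[]. Qed.

Lemma gprod_gamma : gamma_algebra G -> gamma_algebra H -> gamma_algebra gprod.
Proof.
move=> gG gH.
apply: (@gamma_algebra_of_homs _ _ bool (fun b => if b then G else H)
  (fun b => if b return gprod -> (if b then G else H) then fst else snd)).
- by case.
- by case; [apply: gprod_fst_hom | apply: gprod_snd_hom].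
- by case=> x y u0; congr (_, _); [apply: (u0 true) | apply: (u0 false)].
Qed.

End ProductAlgebra.

Section Subalgebra.
Variables (F : fieldType) (G : gradedAlgebra F) (S : submodClosed G).

Record sub_carrier : Type := SubCarrier {
  sub_val :> G;
  sub_valP : sub_val \in S
}.

HB.instance Definition _ := [isSub for sub_val].
HB.instance Definition _ := [Choice of sub_carrier by <:].
HB.instance Definition _ := [SubChoice_isSubLmodule of sub_carrier by <:].

Hypothesis S1 : gone G \in S.
Hypothesis SM : {in S &, forall x y, x *g y \in S}.
Hypothesis Shom : forall x, x \in S -> exists x0 x1,
  [/\ x0 \in S, x0 \in geven G, x1 \in S, x1 \in godd G & x = x0 + x1].

Local Notation T := sub_carrier.

Definition gsub_mul (u v : T) : T := SubCarrier (SM (sub_valP u) (sub_valP v)).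

Definition gsub_part e : {pred T} := fun u => sub_val u \in @gpart _ G e.

Fact gsub_linearl (y : T) : linear (fun x => gsub_mul x y).
Proof. by move=> a u v; apply: val_inj; rewrite /= gmulDl gmulZl. Qed.

Fact gsub_linearr (x : T) : linear (gsub_mul x).
Proof. by move=> a u v; apply: val_inj; rewrite /= linearP. Qed.

Fact gsub_submod e : GRing.submod_closed (gsub_part e).
Proof.
split=> [|a u v]; rewrite -!topredE /gsub_part /= ?rpred0 //.
by move=> ? ?; rewrite rpredD ?rpredZ.
Qed.

Fact gsub_sum (u : T) : exists u0 u1,
  [/\ u0 \in gsub_part false, u1 \in gsub_part true & u = u0 + u1].
Proof.
have [x0 [x1 [Sx0 ex0 Sx1 ox1 def_u]]] := Shom (sub_valP u).
by exists (SubCarrier Sx0), (SubCarrier Sx1); split=> //; apply: val_inj.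
Qed.

Fact gsub_cap (u : T) : u \in gsub_part false -> u \in gsub_part true -> u = 0.
Proof. by move=> eu ou; apply: val_inj; apply: gpart_cap. Qed.

Fact gsub_part_mul d e (u v : T) :
  u \in gsub_part d -> v \in gsub_part e -> gsub_mul u v \in gsub_part (d (+) e).
Proof. exact: gpart_mul. Qed.

Definition gsub : gradedAlgebra F :=
  @GradedAlgebra F T gsub_mul (SubCarrier S1) gsub_part gsub_linearl
    gsub_linearr gsub_submod gsub_sum gsub_cap gsub_part_mul.

Lemma gsub_val_hom : graded_hom (sub_val : gsub -> G).
Proof. by []. Qed.

Lemma gsub_gamma : gamma_algebra G -> gamma_algebra gsub.
Proof.
move=> gG; apply: (@gamma_algebra_of_homs _ gsub unit (fun=> G) (fun=> sub_val)).
- by [].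
- by move=> _; apply: gsub_val_hom.
- by move=> u /(_ tt) u0; apply: val_inj.
Qed.

End Subalgebra.

(** * The algebra S + SV and its universal property *)

Section FreeAlgebra.
Variables (F : fieldType) (n : nat).

Local Notation v := (@vgen F n).
Local Notation S := (standard_span v).

Lemma GammaA_gamma : gamma_algebra (GammaA F n).
Proof. exact: gammaOf_gamma. Qed.

Lemma vgen_odd i : v i \in godd (GammaA F n).
Proof. by rewrite -topredE /= /gammaOf_part. Qed.

Let S_mul : {in S &, forall x y, x *g y \in S}.
Proof. exact: standard_span_mul GammaA_gamma _ vgen_odd. Qed.

Lemma Salg_subalg : GRing.subalg_closed (Salg F n).
Proof.
split=> [|a p q /asboolP pS /asboolP qS|p q /asboolP pS /asboolP qS];
  apply/asboolP=> T closedT genT; have [T1 Tlin Tmul] := closedT.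
- by [].
- by apply: Tlin; [apply: pS | apply: qS].
- by apply: Tmul; [apply: pS | apply: qS].
Qed.

Lemma alpha_word_Salg w : increasing w -> alpha_word F w \in Salg F n.
Proof.
have [S1 _ SM] := Salg_subalg; rewrite /alpha_word.
elim: w => [|p w IHw]; first by rewrite big_nil.
case/andP=> p12 incw; rewrite big_cons; apply: SM; last exact: IHw.
by apply/asboolP=> T _; apply; apply/asboolP; exists p.1, p.2.
Qed.

Lemma evenA_linear : linear (@evenA F n).
Proof. by move=> a p q; congr (_, _); rewrite /= scaler0 addr0. Qed.

HB.instance Definition _ :=
  GRing.isLinear.Build F (polyA F n) (GammaA F n) *:%R (@evenA F n) evenA_linear.

Lemma evenA_span a : a \in Salg F n -> evenA a \in S.
Proof.
move=> /asboolP/(_ (fun a => evenA a \in S)); apply=> [|b /asboolP[i [j [_ ->]]]].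
  split=> [|c p q|p q]; first exact: standard_span_one GammaA_gamma _ vgen_odd.
    rewrite -!topredE /= => pS qS.
    have [_ Slin] := span_by_submod (@standard n) (word_val v).
    by rewrite evenA_linear; apply: Slin.
  rewrite -!topredE /= => pS qS.
  have -> : evenA (p * q) = evenA p *g evenA q by rewrite evenA_mul /= !mulr0.
  exact: S_mul.
rewrite -topredE /= -vgen_mul.
by apply: S_mul; apply: standard_span_gen GammaA_gamma _ vgen_odd _.
Qed.

Lemma span_pred_span u : u \in span_pred v -> u \in S.
Proof.
case/asboolP=> c ->; apply: rpred_sum => i _; apply: rpredZ.
exact: standard_span_gen GammaA_gamma _ vgen_odd _.
Qed.

Lemma word_val_vgen w o : word_val v (w, o) =
  if o is Some j then evenA (alpha_word F w) *g v j else evenA (alpha_word F w).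
Proof.
rewrite /word_val word_act_vgen; case: o => //.
exact: (gamma_mulx1 GammaA_gamma).
Qed.

(** The span of the standard words contains S because it is closed under products
    and contains the v_i, hence the alpha_ij; this needs straightening. *)
Lemma SplusSVE : SplusSV F n =i S.
Proof.
move=> u; apply/idP/idP.
  case/asboolP=> _ [_ [/asboolP[a aS ->] /asboolP[s [sS ->]] ->]].
  rewrite rpredD ?evenA_span // big_seq rpred_sum // => p /(allP sS).
  case/andP=> /asboolP[b bS ->] /span_pred_span; apply: S_mul.
  exact: evenA_span.
have [S1 Slin SM] := Salg_subalg.
have S0 : 0 \in Salg F n by rewrite -(subrr 1) addrC -scaleN1r Slin.
elim/span_by_ind => [|a x y|[w o] /andP[/standard_increasing/= incw _]].
- apply/asboolP; exists 0, 0; rewrite addr0; split=> //.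
    by apply/asboolP; exists 0; rewrite ?linear0.
  by apply/asboolP; exists [::]; rewrite big_nil.
- case/asboolP=> _ [_ [/asboolP[p pS ->] /asboolP[s [sS ->]] ->]].
  case/asboolP=> _ [_ [/asboolP[q qS ->] /asboolP[t [tS ->]] ->]].
  apply/asboolP; exists (evenA (a *: p + q)),
    (\sum_(z <- [seq (a *: z.1, z.2) | z <- s] ++ t) z.1 *g z.2); split.
  + by apply/asboolP; exists (a *: p + q) => //; apply: Slin.
  + apply/asboolP; exists ([seq (a *: z.1, z.2) | z <- s] ++ t); split=> //.
    rewrite all_cat tS andbT all_map; apply/allP=> z /(allP sS) /=.
    case/andP=> /asboolP[b bS ->] ->; rewrite andbT; apply/asboolP.
    exists (a *: b); last by rewrite linearZ.
    by rewrite -[_ *: _]addr0 Slin.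
  + rewrite linearP big_cat big_map /= scalerDr scaler_sumr addrACA.
    by congr (_ + (_ + _)); apply: eq_bigr => z _; exact/esym/(@gmulZl F (GammaA F n)).
rewrite word_val_vgen; apply/asboolP; case: o => [j|].
  exists 0, (evenA (alpha_word F w) *g v j); rewrite add0r; split=> //.
    by apply/asboolP; exists 0; rewrite ?linear0.
  apply/asboolP; exists [:: (evenA (alpha_word F w), v j)].
  rewrite big_seq1 /= andbT; split=> //; apply/andP; split.
    by apply/asboolP; exists (alpha_word F w); rewrite ?alpha_word_Salg.
  apply/asboolP; exists (fun i => (i == j)%:R).
  rewrite (bigD1 j) //= eqxx scale1r big1 ?addr0 // => i /negPf->.
  by rewrite scale0r.
exists (evenA (alpha_word F w)), 0; rewrite addr0; split=> //.
- by apply/asboolP; exists (alpha_word F w); rewrite ?alpha_word_Salg.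
- by apply/asboolP; exists [::]; rewrite big_nil.
Qed.

Lemma SplusSV_subalgebra : subalgebra (SplusSV F n).
Proof.
split; first split; first by rewrite SplusSVE rpred0.
  by move=> a x y; rewrite !SplusSVE => xS yS; rewrite rpredD ?rpredZ.
by move=> x y; rewrite !SplusSVE; apply: S_mul.
Qed.

Lemma GbaseP u : reflect (exists2 k, standard k & word_val v k = u)
  (u \in Gbase F n).
Proof.
apply: (iffP idP) => [/asboolP[[_ /asboolP[w stw ->] ->]|]|[[w o] + <-]].
- by exists (w, None); [apply/andP | rewrite word_val_vgen].
- case=> j [_ [/asboolP[w [stw fromw ->]] ->]].
  by exists (w, Some j); [apply/andP | rewrite word_val_vgen].
rewrite word_val_vgen /standard /= => /andP[stw fromo].
apply/asboolP; case: o fromo => [j|] fromo.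
  right; exists j, (alpha_word F w); split=> //.
  by apply/asboolP; exists w.
by left; exists (alpha_word F w) => //; apply/asboolP; exists w.
Qed.

Lemma word_val_inj : {in @standard n &, injective (word_val v)}.
Proof.
move=> k l stk stl kl; apply: word_mon_inj => //.
have [_ <-] := mlead_word_val F stk.
by rewrite kl; have [] := mlead_word_val F stl.
Qed.

Lemma Gbase_base : base_of (Gbase F n) (SplusSV F n).
Proof.
have [u|key keyP] := @choice (GammaA F n) _
    (fun u k => u \in Gbase F n -> standard k /\ word_val v k = u).
  have [/GbaseP[k stk <-]|//] := boolP (u \in Gbase F n); first by exists k.
  by exists ([::], None).
split=> [u /GbaseP[k stk <-]|u|s c us sB sum0].
- by rewrite SplusSVE; apply: mem_span_by.
- rewrite SplusSVE => /asboolP[s [c [_ stds ->]]].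
  exists [seq word_val v k | k <- s], (c \o key); split=> [u'|].
    by case/mapP=> k /(allP stds) stk ->; apply/GbaseP; exists k.
  rewrite big_map; apply: eq_big_seq => k /(allP stds) stk /=.
  have [stkey /word_val_inj-> //] := keyP _ (introT (GbaseP _) (ex_intro2 _ _ k stk erefl)).
apply: (@word_val_free _ _ _ s c key us) => [u /sB/keyP[] //|u w|].
  by move=> /sB/keyP[_ eu] /sB/keyP[_ ew] /(congr1 (word_val v)); rewrite eu ew.
by rewrite -[RHS]sum0; apply: eq_big_seq => u /sB/keyP[_ ->].
Qed.

Definition freeG : gradedAlgebra F :=
  @gsub F (GammaA F n) S (standard_span_one GammaA_gamma vgen_odd) S_mul
    (standard_span_homogeneous GammaA_gamma vgen_odd).

Definition free_gen (x : Vspace F n) : freeG :=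
  SubCarrier (span_pred_span (span_valP x)).

Lemma free_gen_linear : linear free_gen.
Proof. by move=> a x y; apply: val_inj. Qed.

HB.instance Definition _ :=
  GRing.isLinear.Build F (Vspace F n) freeG *:%R free_gen free_gen_linear.

Fact vgen_span i : v i \in span_pred v.
Proof.
apply/asboolP; exists (fun j => (j == i)%:R).
rewrite (bigD1 i) //= eqxx scale1r big1 ?addr0 // => j /negPf->.
by rewrite scale0r.
Qed.

Definition Vgen i : Vspace F n := SpanSpace (vgen_span i).

Lemma Vspace_sum (x : Vspace F n) : exists c, x = \sum_i c i *: Vgen i.
Proof.
have /asboolP[c def_x] := span_valP x; exists c; apply: val_inj.
by rewrite raddf_sum; exact: def_x.
Qed.

Lemma free_gen_odd x : free_gen x \in godd freeG.
Proof.
have [c ->] := Vspace_sum x; rewrite linear_sum rpred_sum // => i _.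
by rewrite linearZ rpredZ //; apply: vgen_odd.
Qed.

Lemma freeG_span (g : freeG) : g \in standard_span (free_gen \o Vgen).
Proof.
have /asboolP[s [c [us stds def_g]]] := sub_valP g.
apply/asboolP; exists s, c; split=> //; apply: val_inj.
rewrite raddf_sum [LHS]def_g; apply: eq_bigr => k _.
rewrite [RHS]GRing.valZ; congr (_ *: _).
by rewrite [RHS](ghom_word_val (gsub_val_hom _ _ _)).
Qed.

(** The span of the standard words in the [h i] is a subalgebra of [K], and it is
    the graph of the extension of [f]. *)
Section Extension.
Variables (H : gradedAlgebra F) (f : {linear Vspace F n -> H}).
Hypothesis gH : gamma_algebra H.
Hypothesis fodd : forall x, f x \in godd H.

Let K := gprod (GammaA F n) H.
Let h i : K := (v i, f (Vgen i)).
Let gK : gamma_algebra K := gprod_gamma GammaA_gamma gH.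

Let hodd i : h i \in godd K.
Proof. by apply/andP; split; [apply: vgen_odd | apply: fodd]. Qed.

Let homfst : graded_hom (fst : K -> _) := gprod_fst_hom _ _.

(** This is where the independence of the standard words in Gamma(A_n) enters. *)
Let graph_inj (d : K) : d \in standard_span h -> d.1 = 0 -> d = 0.
Proof.
case/asboolP=> s [c [us stds ->]] sum0.
rewrite big_seq big1 // => k ks; suff -> : c k = 0 by rewrite scale0r.
apply: (@word_val_free _ _ _ s c id us) => // [k'|].
  by move/(allP stds).
rewrite -[RHS]sum0 (raddf_sum fst); apply: eq_bigr => k' _ /=.
by rewrite (ghom_word_val homfst).
Qed.

(** The component of d of the wrong parity has first component zero, hence
    vanishes. *)
Let graph_part e (d : K) : d \in standard_span h ->
  d.1 \in @gpart _ (GammaA F n) e -> d \in @gpart _ K e.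
Proof.
move=> dS; have [d0 [d1 [d0S ed0 d1S od1 ->]]] :=
  standard_span_homogeneous gK hodd dS.
have [/andP[ed0_1 _] /andP[od1_1 _]] := (ed0, od1).
case: e => ed.
  suff /graph_inj-> : d0.1 = 0 by rewrite ?add0r.
  by apply: gpart_cap => //; rewrite -(addrK d1.1 d0.1) rpredB.
suff /graph_inj-> : d1.1 = 0 by rewrite ?addr0.
by apply: gpart_cap => //; rewrite -(addKr d0.1 d1.1) rpredD ?rpredN.
Qed.

Let graph_lift (g : freeG) : exists d : K, d \in standard_span h /\ d.1 = sub_val g.
Proof.
have := sub_valP g; elim/span_by_ind => [|a x y|k stk].
- by exists 0; split; [apply: rpred0 | apply: (ghom0 homfst)].
- move=> [d [dS <-]] [e [eS <-]].
  exists (a *: d + e); split; first by rewrite rpredD ?rpredZ.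
  exact: (ghomP homfst).
exists (word_val h k); split; first exact: mem_span_by.
by rewrite (ghom_word_val homfst).
Qed.

Lemma free_extension : exists phi : freeG -> H,
  [/\ graded_hom phi, forall x, phi (free_gen x) = f x
    & forall psi : freeG -> H, graded_hom psi ->
        (forall x, psi (free_gen x) = f x) -> psi =1 phi].
Proof.
have [lift liftP] := choice graph_lift.
have lift_uniq g d : d \in standard_span h -> d.1 = sub_val g -> lift g = d.
  move=> dS dg; have [gS gg] := liftP g; apply/subr0_eq/graph_inj.
    by rewrite rpredB.
  by rewrite /= gg dg subrr.
pose phi g := (lift g).2.
have hom_phi : graded_hom phi.
  split=> [a x y|x y||e x ex]; rewrite /phi.
  - have [[xS xx] [yS yy]] := (liftP x, liftP y).
    rewrite (@lift_uniq _ (a *: lift x + lift y)) ?rpredD ?rpredZ //.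
    by rewrite /= xx yy.
  - have [[xS xx] [yS yy]] := (liftP x, liftP y).
    rewrite (@lift_uniq _ (lift x *g lift y)) ?(standard_span_mul gK hodd) //.
    by rewrite /= xx yy.
  - by rewrite (@lift_uniq _ (gone K)) ?(standard_span_one gK hodd).
  have [xS xx] := liftP x; rewrite -topredE /= /gsub_part -xx in ex.
  by have /andP[] := graph_part xS ex.
have phi_gen x : phi (free_gen x) = f x.
  have [c def_x] := Vspace_sum x; rewrite /phi.
  rewrite (@lift_uniq _ (\sum_i c i *: h i)).
  - rewrite (raddf_sum snd) [in RHS]def_x linear_sum /=; apply: eq_bigr => i _.
    by rewrite linearZ.
  - apply: rpred_sum => i _; apply: rpredZ.
    exact: (standard_span_gen gK hodd).
  - have /(congr1 val) := def_x; rewrite raddf_sum (raddf_sum fst) => def_vx.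
    exact: esym def_vx.
exists phi; split=> // psi hom_psi psi_gen g.
apply: (ghom_eq_span hom_psi hom_phi _ (freeG_span g)) => i.
by rewrite psi_gen phi_gen.
Qed.

End Extension.
End FreeAlgebra.

Theorem theorem7 (F : fieldType) (n : nat) (n_gt0 : (0 < n)%N) :
  [/\ subalgebra (SplusSV F n),
      exists (G : gradedAlgebra F) (iota : {linear Vspace F n -> G})
             (phi : G -> GammaA F n),
        [/\ free_gamma iota,
            graded_hom phi,
            injective phi,
            (forall u, u \in SplusSV F n <-> exists g, phi g = u)
          & forall v : Vspace F n, phi (iota v) = span_val v]
    & base_of (Gbase F n) (SplusSV F n)].
Proof.
split; [exact: SplusSV_subalgebra | | exact: Gbase_base].
exists (freeG F n), (@free_gen F n), (@sub_val _ _ _); split=> //.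
- split; [| exact: free_gen_odd | exact: free_extension].
  exact/gsub_gamma/GammaA_gamma.
- exact: val_inj.
move=> u; rewrite SplusSVE; split=> [uS|[g <-]]; last exact: sub_valP.
by exists (SubCarrier uS).
Qed.
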